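(* Let $\mathcal{X}\subseteq\mathbb{R}^d$ be nonempty, closed and convex, and let $V:\mathbb{R}^d\to\mathbb{R}^d$ be a monotone, $\beta$-Lipschitz continuous operator ($\beta>0$) such that the variational inequality ''find $x^\star\in\mathcal{X}$ with $\langle V(x^\star),x-x^\star\rangle\ge 0$ for all $x\in\mathcal{X}$'' has at least one solution. Assume that one of the algorithms (PEG), (RG), (OG) described in the context is run with perfect oracle feedback and a constant step-size $0<\gamma<1/(c\beta)$, where $c=1+\sqrt{2}$ for (RG) and $c=2$ for (PEG) and (OG). Then, for all $R>0$ and all integers $t\ge 1$, $$\mathrm{Err}_R(\bar X_t)\le \frac{R^2+\|X_1-X_{1/2}\|^2}{2\gamma t},$$ where $\bar X_t=t^{-1}\sum_{s=1}^{t}X_{s+1/2}$ is the ergodic average of the algorithm's leading states.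
   Context: $\|\cdot\|$ is the Euclidean norm on $\mathbb{R}^d$ and $\Pi_{\mathcal{X}}(y)=\arg\min_{x\in\mathcal{X}}\|y-x\|$ is the Euclidean projection. $V$ is monotone if $\langle V(x')-V(x),x'-x\rangle\ge 0$ for all $x,x'\in\mathbb{R}^d$, and $\beta$-Lipschitz if $\|V(x')-V(x)\|\le\beta\|x'-x\|$ for all $x,x'\in\mathbb{R}^d$. Algorithms with perfect oracle feedback and constant step-size $\gamma>0$, for $t=1,2,\dots$: (PEG), Past Extra-Gradient: $X_{t+1/2}=\Pi_{\mathcal{X}}(X_t-\gamma V(X_{t-1/2}))$, $X_{t+1}=\Pi_{\mathcal{X}}(X_t-\gamma V(X_{t+1/2}))$, initialized with arbitrary $X_{1/2},X_1\in\mathcal{X}$. (RG), Reflected Gradient: $X_{t+1/2}=X_t-(X_{t-1}-X_t)=2X_t-X_{t-1}$, $X_{t+1}=\Pi_{\mathcal{X}}(X_t-\gamma V(X_{t+1/2}))$, initialized with arbitrary $X_0,X_{1/2}\in\mathcal{X}$ and $X_1=\Pi_{\mathcal{X}}(X_0-\gamma V(X_{1/2}))$. (OG), Optimistic Gradient: $X_{t+1/2}=\Pi_{\mathcal{X}}(X_t-\gamma V(X_{t-1/2}))$, $X_{t+1}=X_{t+1/2}+\gamma V(X_{t-1/2})-\gamma V(X_{t+1/2})$, initialized with arbitrary $X_{1/2},X_1\in\mathcal{X}$. Restricted error function: for $R>0$ let $\mathcal{X}_R=\{x\in\mathcal{X}:\|x-X_1\|\le R\}$ and $\mathrm{Err}_R(\hat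 x)=\max_{x\in\mathcal{X}_R}\langle V(x),\hat x-x\rangle$. *)

(* Defs.v *)
From HB Require Import structures.
From mathcomp Require Import all_boot all_order all_algebra.
From mathcomp Require Import ring lra.
From mathcomp Require Import all_classical all_reals all_analysis.

Set Implicit Arguments.
Unset Strict Implicit.
Unset Printing Implicit Defensive.

Import Order.TTheory GRing.Theory Num.Theory.
Import numFieldNormedType.Exports.

Local Open Scope classical_set_scope.
Local Open Scope ring_scope.

(* The library norm `|u| on 'rV[R]_d is the sup norm, hence a separate
   Euclidean norm.  Both induce the topology used by [closed]. *)
Definition dot {R : realType} {d : nat} (u v : 'rV[R]_d) : R :=
  \sum_(i < d) u 0 i * v 0 i.

Definition enorm {R : realType} {d : nat} (u : 'rV[R]_d) : R :=
  Num.sqrt (dot u u).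

Definition argmin {R : realType} {T : Type} (X : set T) (f : T -> R) : set T :=
  [set p | X p /\ forall x, X x -> f p <= f x].

(* The default 0 is never taken when X is nonempty and closed, see
   [proj_argmin]; the minimizer is unique if X is also convex, see
   [proj_unique]. *)
Definition proj {R : realType} {d : nat} (X : set 'rV[R]_d) (y : 'rV[R]_d)
    : 'rV[R]_d :=
  xget 0 (argmin X (fun x => enorm (y - x))).

Definition monotone_operator {R : realType} {d : nat}
    (V : 'rV[R]_d -> 'rV[R]_d) :=
  forall x x', 0 <= dot (V x' - V x) (x' - x).

Definition lipschitz_operator {R : realType} {d : nat} (beta : R)
    (V : 'rV[R]_d -> 'rV[R]_d) :=
  forall x x', enorm (V x' - V x) <= beta * enorm (x' - x).

Definition vi_solution {R : realType} {d : nat} (X : set 'rV[R]_d)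
    (V : 'rV[R]_d -> 'rV[R]_d) (xs : 'rV[R]_d) :=
  X xs /\ forall x, X x -> 0 <= dot (V xs) (x - xs).

Inductive algorithm := PEG | RG | OG.

Definition step_const {R : realType} (alg : algorithm) : R :=
  match alg with
  | RG => 1 + Num.sqrt 2
  | PEG | OG => 2
  end.

(* Half-integer indices: [x t] stands for X_t and [xh t] for X_(t + 1/2), so
   that X_(t - 1/2) is [xh t.-1] for t >= 1 and X_(1/2) is [xh 0].  The value
   [x 0] only matters for RG. *)
Definition PEG_run {R : realType} {d : nat} (X : set 'rV[R]_d)
    (V : 'rV[R]_d -> 'rV[R]_d) (gamma : R) (x xh : nat -> 'rV[R]_d) :=
  [/\ X (xh 0%N), X (x 1%N) &
   forall t, (1 <= t)%N ->
     xh t = proj X (x t - gamma *: V (xh t.-1)) /\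
     x t.+1 = proj X (x t - gamma *: V (xh t))].

Definition RG_run {R : realType} {d : nat} (X : set 'rV[R]_d)
    (V : 'rV[R]_d -> 'rV[R]_d) (gamma : R) (x xh : nat -> 'rV[R]_d) :=
  [/\ X (x 0%N), X (xh 0%N), x 1%N = proj X (x 0%N - gamma *: V (xh 0%N)) &
   forall t, (1 <= t)%N ->
     xh t = x t - (x t.-1 - x t) /\
     x t.+1 = proj X (x t - gamma *: V (xh t))].

Definition OG_run {R : realType} {d : nat} (X : set 'rV[R]_d)
    (V : 'rV[R]_d -> 'rV[R]_d) (gamma : R) (x xh : nat -> 'rV[R]_d) :=
  [/\ X (xh 0%N), X (x 1%N) &
   forall t, (1 <= t)%N ->
     xh t = proj X (x t - gamma *: V (xh t.-1)) /\
     x t.+1 = xh t + gamma *: V (xh t.-1) - gamma *: V (xh t)].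

Definition run (alg : algorithm) {R : realType} {d : nat} :=
  match alg with
  | PEG => @PEG_run R d
  | RG => @RG_run R d
  | OG => @OG_run R d
  end.

(* The default 0 is never taken for the sets to which [setmax] is applied
   below, see [Err_max]. *)
Definition setmax {R : realType} (A : set R) : R := xget 0 (A `&` ubound A).

Definition restr {R : realType} {d : nat} (X : set 'rV[R]_d) (x1 : 'rV[R]_d)
    (r : R) : set 'rV[R]_d :=
  [set x | X x /\ enorm (x - x1) <= r].

Definition Err {R : realType} {d : nat} (X : set 'rV[R]_d)
    (V : 'rV[R]_d -> 'rV[R]_d) (x1 : 'rV[R]_d) (r : R) (xhat : 'rV[R]_d) : R :=
  setmax [set dot (V x) (xhat - x) | x in restr X x1 r].

Definition ergodic_average {R : realType} {d : nat} (xh : nat -> 'rV[R]_d)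
    (t : nat) : 'rV[R]_d :=
  t%:R^-1 *: \sum_(1 <= s < t.+1) xh s.

Section Well_definedness.
Variables (R : realType) (d : nat).
Implicit Types (u v x y : 'rV[R]_d) (X : set 'rV[R]_d).

Lemma dot_ge0 u : 0 <= dot u u.
Proof. by apply: sumr_ge0 => i _; rewrite -expr2 sqr_ge0. Qed.

Lemma sqr_enorm u : enorm u ^+ 2 = dot u u.
Proof. by rewrite sqr_sqrtr// dot_ge0. Qed.

Lemma enorm_ge0 u : 0 <= enorm u.
Proof. exact: sqrtr_ge0. Qed.

Lemma coord_le_enorm u i : `|u 0 i| <= enorm u.
Proof.
rewrite -sqrtr_sqr ler_wsqrtr// expr2 /dot (bigD1 i)//= lerDl.
by apply: sumr_ge0 => j _; rewrite -expr2 sqr_ge0.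
Qed.

Lemma norm_le_enorm u : `|u| <= enorm u.
Proof.
rewrite [leLHS]/Num.norm /= mx_normrE; apply/bigmax_leP; split=> [|[j i] _] /=.
  exact: enorm_ge0.
by rewrite (ord1 j); exact: coord_le_enorm.
Qed.

Lemma dot_cvg (T : topologicalType) (F : set_system T) (FF : Filter F)
    (f g : T -> 'rV[R]_d) (a b : 'rV[R]_d) :
  (forall i, f x 0 i @[x --> F] --> a 0 i) ->
  (forall i, g x 0 i @[x --> F] --> b 0 i) ->
  dot (f x) (g x) @[x --> F] --> dot a b.
Proof.
move=> fa gb; rewrite /dot; apply: cvg_big => [|i _].
  exact: add_continuous.
by apply: cvgM; [exact: fa|exact: gb].
Qed.

Lemma coordB_cvg (c x : 'rV[R]_d) i : (c - y) 0 i @[y --> x] --> (c - x) 0 i.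
Proof.
have -> : (fun y : 'rV[R]_d => (c - y) 0 i) = (fun y => c 0 i - y 0 i).
  by apply/funext => y; rewrite !mxE.
have -> : (c - x) 0 i = c 0 i - x 0 i by rewrite !mxE.
by apply: (@cvgB R R^o _ (nbhs x) _ (fun=> c 0 i) (fun y => y 0 i) _ _
  (cvg_cst _)); exact: coord_continuous.
Qed.

Lemma enormB_cvg (c x : 'rV[R]_d) : enorm (c - y) @[y --> x] --> enorm (c - x).
Proof.
apply: (@cvg_comp _ _ _ (fun y => dot (c - y) (c - y)) Num.sqrt _
  (nbhs (dot (c - x) (c - x)))); last exact: sqrt_continuous.
by apply: (dot_cvg (nbhs_filter x)) => i; exact: coordB_cvg.
Qed.

Lemma enormC u v : enorm (u - v) = enorm (v - u).
Proof.
rewrite /enorm /dot; congr Num.sqrt; apply: eq_bigr => i _.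
by rewrite !mxE; ring.
Qed.

Lemma enorm0 : enorm (0 : 'rV[R]_d) = 0.
Proof. by rewrite /enorm /dot big1 ?sqrtr0// => i _; rewrite mxE mul0r. Qed.

Lemma restr_compact X c r : closed X -> compact (restr X c r).
Proof.
move=> Xc; apply: bounded_closed_compact.
  exists (r + `|c|); split=> [|M rM x [_ xr]]; first exact: num_real.
  apply: le_trans (ltW rM).
  rewrite -[x in leLHS](subrK c); apply: le_trans (ler_normD _ _) _.
  by rewrite lerD2r; exact: le_trans (norm_le_enorm _) xr.
have -> : restr X c r = X `&` [set x | enorm (c - x) <= r].
  by apply/seteqP; split=> x [Xx /= xr]; split=> //=; rewrite enormC.
apply: closedI => //.
have -> : [set x | enorm (c - x) <= r] =
    (fun x => enorm (c - x)) @^-1` [set y | y <= r] by [].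
apply: closed_comp; last exact: closed_le.
by move=> x _; exact: enormB_cvg.
Qed.

Lemma proj_argmin X y : X !=set0 -> closed X ->
  argmin X (fun x => enorm (y - x)) (proj X y).
Proof.
move=> [x0 Xx0] Xc; apply: xgetPex.
have [|x|p pA pmin] :=
    @EVT_min_rV R d (fun x => enorm (y - x)) _ _
      (@restr_compact X y (enorm (y - x0)) Xc).
- by exists x0; split=> //; rewrite enormC.
- by apply: continuous_subspaceT => z; exact: enormB_cvg.
move: pA; rewrite inE => -[Xp pr].
exists p; split=> // x Xx; have [xr|xr] := leP (enorm (x - y)) (enorm (y - x0)).
  by apply: pmin; rewrite inE; split.
by rewrite /= (enormC y p) (enormC y x) (le_trans pr)// ltW.
Qed.

Lemma proj_unique X y p : convex_set X ->
  argmin X (fun x => enorm (y - x)) p -> proj X y = p.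
Proof.
move=> Xcvx minp.
apply: xget_unique => // q [Xq qmin]; have [Xp pmin] := minp.
have pq : enorm (y - p) = enorm (y - q).
  by apply/eqP; rewrite eq_le pmin// qmin.
pose h : R := 2^-1.
have [h0 h1] : 0 <= h /\ h <= 1 by rewrite /h; lra.
have Xm : X (h *: p + h *: q).
  pose k : {i01 R} := Itv01 h0 h1.
  have E : conv k (p : convex_lmodType 'rV[R]_d) q = h *: p + (1 - h) *: q.
    by [].
  have {2}-> : h = 1 - h by rewrite /h; lra.
  by rewrite -E; exact: set_mem (Xcvx p q k (mem_set Xp) (mem_set Xq)).
have key : dot (y - (h *: p + h *: q)) (y - (h *: p + h *: q)) =
   h * dot (y - p) (y - p) + h * dot (y - q) (y - q)
   - h ^+ 2 * dot (q - p) (q - p).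
  rewrite /dot !mulr_sumr -big_split/= -sumrB; apply: eq_bigr => i _.
  by rewrite !mxE /h; field.
have := pmin _ Xm; rewrite -(@ler_pXn2r _ 2)// ?nnegrE ?enorm_ge0//.
rewrite !sqr_enorm key -!sqr_enorm -pq => le_p.
set a := enorm (y - p) in le_p; set b := enorm (q - p) in le_p.
have qp0 : b ^+ 2 <= 0 by move: le_p; rewrite /h; lra.
apply/rowP => i; apply/eqP; rewrite -subr_eq0 -normr_le0.
have := coord_le_enorm (q - p) i; rewrite !mxE => /le_trans; apply.
by rewrite -/b; nra.
Qed.

Lemma elipschitz_coord_cvg beta (V : 'rV[R]_d -> 'rV[R]_d) x i :
  lipschitz_operator beta V -> V y 0 i @[y --> x] --> V x 0 i.
Proof.
move=> VL.
have bx0 : beta * enorm (x - y) @[y --> x] --> (0 : R).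
  have : beta * enorm (x - y) @[y --> x] --> beta * enorm (x - x).
    by apply: (@cvgM R _ (nbhs x) _ (fun=> beta) (fun y => enorm (x - y)) _ _
      (cvg_cst _)); exact: enormB_cvg.
  by rewrite subrr enorm0 mulr0.
apply/(@cvgrPdist_le _ _ _ _ (nbhs_filter x)) => e e0.
move/(@cvgrPdist_le _ _ _ _ (nbhs_filter x)) : bx0 => /(_ _ e0).
apply: (@filterS _ _ (nbhs_filter x)) => y /=.
rewrite sub0r normrN => ye.
have := coord_le_enorm (V x - V y) i; rewrite !mxE => /le_trans; apply.
by rewrite (le_trans (VL _ _))// (le_trans _ ye)// ler_norm.
Qed.

Lemma Err_max X (V : 'rV[R]_d -> 'rV[R]_d) beta x1 r xhat :
    closed X -> X x1 -> 0 <= r -> lipschitz_operator beta V ->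
  let E := [set dot (V x) (xhat - x) | x in restr X x1 r] in
  E (Err X V x1 r xhat) /\ ubound E (Err X V x1 r xhat).
Proof.
move=> Xc Xx1 r0 VL E; apply: (@xgetPex _ 0 (E `&` ubound E)).
have [|x|p pA pmax] :=
    @EVT_max_rV R d (fun x => dot (V x) (xhat - x)) _ _
      (@restr_compact X x1 r Xc).
- by exists x1; split=> //; rewrite subrr enorm0.
- apply: continuous_subspaceT => z; apply: (dot_cvg (nbhs_filter z)) => i.
    exact: elipschitz_coord_cvg VL.
  exact: coordB_cvg.
rewrite inE in pA; exists (dot (V p) (xhat - p)); split; first by exists p.
by move=> _ [x xA <-]; apply: pmax; rewrite inE.
Qed.

End Well_definedness.

(* Main.v *)
Require Import Defs.
From mathcomp Require Import all_boot all_order all_algebra.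
From mathcomp Require Import ring lra.
From mathcomp Require Import all_classical all_reals all_analysis.

Set Implicit Arguments.
Unset Strict Implicit.
Unset Printing Implicit Defensive.

Import Order.TTheory GRing.Theory Num.Theory.
Import numFieldNormedType.Exports.

Local Open Scope classical_set_scope.
Local Open Scope ring_scope.

(** Fix a point [p] of [X], write [L = gamma * beta], and let
    [e_t = X_t - X_(t - 1/2)] be the gap between a base state and the leading
    state that precedes it.  All three algorithms admit a Lyapunov inequality
      [|X_(t+1) - p|^2 + k |e_(t+1)|^2 + 2 gamma <V X_(t+1/2), X_(t+1/2) - p>
         <= |X_t - p|^2 + k |e_t|^2]
    with a weight [k] in [[0, 1]] ([energy_decrease]).

    For PEG and OG, the variational inequality of the projection
    ([proj_variational]) gives a descent inequality whose error term is
    [gamma^2 |V X_(t+1/2) - V X_(t-1/2)|^2 - |X_(t+1/2) - X_t|^2], while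
    [|e_(t+1)|^2] is at most [gamma^2 |V X_(t+1/2) - V X_(t-1/2)|^2], because
    the projection is nonexpansive (PEG) or by definition (OG).
    By Lipschitz continuity and [|u + v|^2 <= 2 |u|^2 + 2 |v|^2], the weight
    [k = 1] works as soon as [4 L^2 <= 1].

    For RG, the variational inequality at [X_t], tested against both [X_(t-1)]
    and [X_(t+1)], bounds [<V X_(t-1/2), X_(t+1/2) - X_(t+1)>], because
    [X_(t+1/2) - X_(t+1) = (X_t - X_(t+1)) + (X_t - X_(t-1))].  Weighted Young
    inequalities then give [k = L] as soon as [L^2 + 2 L <= 1], that is,
    [L <= sqrt 2 - 1].

    Summing over the iterations bounds
    [\sum_s 2 gamma <V X_(s+1/2), X_(s+1/2) - p>]
    by [|X_1 - p|^2 + |X_1 - X_(1/2)|^2]; monotonicity of [V] replaces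
    [V X_(s+1/2)] by [V p], after which the sum is linear in the leading states
    and so is a multiple of the value at the ergodic average. *)

(** * Bilinearity of the Euclidean inner product *)

Section Dot.
Variables (R : realType) (d : nat).
Implicit Types (u v w : 'rV[R]_d) (a : R).

Lemma dotC u v : dot u v = dot v u.
Proof. by apply: eq_bigr => i _; rewrite mulrC. Qed.

Lemma dotDl u v w : dot (u + v) w = dot u w + dot v w.
Proof.
by rewrite /dot -big_split/=; apply: eq_bigr => i _; rewrite mxE mulrDl.
Qed.

Lemma dotZl a u v : dot (a *: u) v = a * dot u v.
Proof. by rewrite /dot mulr_sumr; apply: eq_bigr => i _; rewrite mxE mulrA. Qed.

Lemma dotNl u v : dot (- u) v = - dot u v.
Proof. by rewrite -scaleN1r dotZl mulN1r. Qed.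

Lemma dotDr u v w : dot u (v + w) = dot u v + dot u w.
Proof. by rewrite dotC dotDl !(dotC u). Qed.

Lemma dotZr a u v : dot u (a *: v) = a * dot u v.
Proof. by rewrite dotC dotZl (dotC u). Qed.

Lemma dotNr u v : dot u (- v) = - dot u v.
Proof. by rewrite dotC dotNl (dotC u). Qed.

Lemma dot_subZ a u v :
  dot (u - a *: v) (u - a *: v) = dot u u - 2 * a * dot u v + a ^+ 2 * dot v v.
Proof.
by rewrite !(dotDl, dotDr, dotNl, dotNr, dotZl, dotZr) (dotC v u); ring.
Qed.

Lemma dot_sumr (I : Type) (s : seq I) (P : pred I) u (F : I -> 'rV[R]_d) :
  dot u (\sum_(i <- s | P i) F i) = \sum_(i <- s | P i) dot u (F i).
Proof.
apply: (big_morph (dot u)) => [v w|]; first exact: dotDr.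
by rewrite -(scale0r u) dotZr mul0r.
Qed.

Definition dotE := (dotDl, dotDr, dotNl, dotNr).

End Dot.

(** * Projection onto a convex set *)

(** [Defs.proj] is the Euclidean projection; the unqualified [proj] is the
    coordinate map of a product space. *)

Section Projection.
Variables (R : realType) (d : nat) (X : set 'rV[R]_d).
Hypotheses (X_nonempty : X !=set0) (X_closed : closed X)
  (X_convex : convex_set X).
Implicit Types (x h y z p a b u v : 'rV[R]_d).

Lemma proj_in y : X (Defs.proj X y).
Proof. by have [] := proj_argmin y X_nonempty X_closed. Qed.

Lemma convex_segment p z (k : R) :
  0 <= k -> k <= 1 -> X p -> X z -> X (p + k *: (z - p)).
Proof.
move=> k0 k1 Xp Xz.
pose i : {i01 R} := Itv01 k0 k1.
have E : conv i (z : convex_lmodType 'rV[R]_d) p = k *: z + (1 - k) *: p by [].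
have -> : p + k *: (z - p) = k *: z + (1 - k) *: p.
  by apply/rowP => j; rewrite !mxE; ring.
by rewrite -E; exact: set_mem (X_convex i (mem_set Xz) (mem_set Xp)).
Qed.

(** The vector from the projection of [y] to [y] makes an obtuse angle with
    every direction that points into [X]. *)
Lemma proj_variational y z : X z ->
  dot (y - Defs.proj X y) (z - Defs.proj X y) <= 0.
Proof.
move=> Xz; have [] := proj_argmin y X_nonempty X_closed.
set p := Defs.proj X y => Xp pmin; rewrite leNgt; apply/negP => s0.
set s := dot _ _ in s0; set n := dot (z - p) (z - p).
have n0 : 0 <= n := dot_ge0 _.
have sn0 : 0 < s + n by lra.
(* Moving from [p] towards [z] by [k] changes the squared distance to [y] by
   [k^2 n - 2 k s], which is negative for this [k]. *)
pose k := s / (s + n).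
have k0 : 0 < k by rewrite divr_gt0.
have k1 : k <= 1 by rewrite ler_pdivrMr// mul1r; lra.
have kE : k * (s + n) = s by rewrite /k divfK// gt_eqF.
have := pmin _ (convex_segment (ltW k0) k1 Xp Xz).
rewrite -(@ler_pXn2r _ 2)// ?nnegrE ?enorm_ge0// !sqr_enorm.
have -> : y - (p + k *: (z - p)) = (y - p) - k *: (z - p).
  by rewrite opprD addrA.
rewrite dot_subZ -/s -/n => H.
have ks : k * (2 * s) <= k * (k * n) by lra.
rewrite ler_pM2l// in ks.
by nra.
Qed.

(** * One step of each algorithm *)

(** Here [x], [h] and [x'] stand for [X_t], [X_(t+1/2)] and [X_(t+1)], and [a]
    and [b] for [gamma V X_(t-1/2)] and [gamma V X_(t+1/2)].  The second
    inequality says that the projection is nonexpansive. *)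
Lemma PEG_step x a b p : X p ->
  let h := Defs.proj X (x - a) in let x' := Defs.proj X (x - b) in
  dot (x' - p) (x' - p) + 2 * dot b (h - p) + dot (h - x) (h - x)
    <= dot (x - p) (x - p) + dot (b - a) (b - a) /\
  dot (x' - h) (x' - h) <= dot (b - a) (b - a).
Proof.
move=> Xp h x'.
have h1 := proj_variational (x - a) (proj_in (x - b) : X x').
have h2 := proj_variational (x - b) (proj_in (x - a) : X h).
have h3 := proj_variational (x - b) Xp.
have h4 := dot_ge0 (b - a - (h - x')).
rewrite -/h -/x' in h1 h2 h3; move: h x' h1 h2 h3 h4 => h x'.
rewrite !dotE ?(dotC a x) ?(dotC b x) ?(dotC h x) ?(dotC x' x) ?(dotC p x)
  ?(dotC b a) ?(dotC h a) ?(dotC x' a) ?(dotC p a)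
  ?(dotC h b) ?(dotC x' b) ?(dotC p b) ?(dotC x' h) ?(dotC p h) ?(dotC p x').
by split; lra.
Qed.

(** The same bounds for OG; the second one is an equality, since
    [x' - h = a - b]. *)
Lemma OG_step x a b p : X p ->
  let h := Defs.proj X (x - a) in let x' := h + a - b in
  dot (x' - p) (x' - p) + 2 * dot b (h - p) + dot (h - x) (h - x)
    <= dot (x - p) (x - p) + dot (b - a) (b - a) /\
  dot (x' - h) (x' - h) <= dot (b - a) (b - a).
Proof.
move=> Xp h x'.
have h1 := proj_variational (x - a) Xp.
rewrite -/h in h1; rewrite /x'; move: h {x'} h1 => h.
rewrite !dotE ?(dotC a x) ?(dotC b x) ?(dotC h x) ?(dotC p x)
  ?(dotC b a) ?(dotC h a) ?(dotC p a) ?(dotC h b) ?(dotC p b) ?(dotC p h).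
by split; lra.
Qed.

(** With the same notation, and [x0] for [X_(t-1)]. *)
Lemma RG_step x0 x x' h a b p : X p -> X x0 ->
  x = Defs.proj X (x0 - a) -> x' = Defs.proj X (x - b) -> h = x - (x0 - x) ->
  dot (x' - p) (x' - p) + 2 * dot b (h - p) + dot (h - x) (h - x)
    + dot (x' - h) (x' - h)
    <= dot (x - p) (x - p) + 2 * dot (b - a) (h - x').
Proof.
move=> Xp Xx0 xE x'E ->.
have Xx' : X x' by rewrite x'E; exact: proj_in.
have h1 := proj_variational (x0 - a) Xx0.
have h2 := proj_variational (x0 - a) Xx'.
have h3 := proj_variational (x - b) Xp.
rewrite -xE -?x'E in h1 h2 h3; move: h1 h2 h3.
rewrite !dotE ?(dotC a x) ?(dotC b x) ?(dotC x0 x) ?(dotC x' x) ?(dotC p x)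
  ?(dotC b a) ?(dotC x0 a) ?(dotC x' a) ?(dotC p a)
  ?(dotC x0 b) ?(dotC x' b) ?(dotC p b) ?(dotC x' x0) ?(dotC p x0) ?(dotC p x').
by lra.
Qed.

End Projection.

(** * Choice of the constants *)

Section Energy.
Variables (R : realType) (d : nat).
Implicit Types (u v w : 'rV[R]_d).

(** The Young inequality [|u + v|^2 <= (1 + 1/c) |u|^2 + (1 + c) |v|^2] for
    [c > 0], multiplied by [c]. *)
Lemma dotD_young (c : R) u v : 0 <= c ->
  c * dot (u + v) (u + v) <= (1 + c) * (dot u u + c * dot v v).
Proof.
move=> c0; have := dot_ge0 (u - c *: v).
by rewrite dot_subZ !dotE (dotC v u); lra.
Qed.

Lemma dot_young (c : R) u v : 0 < c ->
  2 * dot u v <= c^-1 * dot u u + c * dot v v.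
Proof.
move=> c0; have := dot_ge0 (u - c *: v).
rewrite dot_subZ => H.
rewrite -(ler_pM2l c0) mulrDr mulVKf ?gt_eqF//.
by lra.
Qed.

Lemma lipschitz_sqr (beta gamma : R) (V : 'rV[R]_d -> 'rV[R]_d) u v :
  0 <= beta -> lipschitz_operator beta V ->
  dot (gamma *: V v - gamma *: V u) (gamma *: V v - gamma *: V u)
    <= (gamma * beta) ^+ 2 * dot (v - u) (v - u).
Proof.
move=> beta0 VL; rewrite -scalerBr dotZl dotZr mulrA -expr2 exprMn.
rewrite -[leRHS]mulrA ler_wpM2l ?sqr_ge0// -!sqr_enorm -exprMn.
by rewrite ler_pXn2r ?nnegrE ?mulr_ge0 ?enorm_ge0//; exact: VL.
Qed.

(** The combination of constants shared by PEG and OG: [h0], [x], [h], [x']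
    stand for [X_(t-1/2)], [X_t], [X_(t+1/2)], [X_(t+1)], and [q] for
    [gamma^2 |V h - V h0|^2]. *)
Lemma past_gap (L q : R) (h0 x h x' : 'rV[R]_d) :
  0 <= L -> 2 * L <= 1 -> q <= L ^+ 2 * dot (h - h0) (h - h0) ->
  dot (x' - h) (x' - h) <= q ->
  q + dot (x' - h) (x' - h) <= dot (h - x) (h - x) + dot (x - h0) (x - h0).
Proof.
move=> L0 L2 qL gq.
have := dotD_young (h - x) (x - h0) ler01.
rewrite !mul1r addrA subrK => Y.
have L4 : 4 * L ^+ 2 <= 1 by nra.
have D0 := dot_ge0 (h - h0).
by nra.
Qed.

(** The combination of constants for RG, with the same notation; [w] stands
    for [gamma (V h - V h0)]. *)
Lemma reflected_gap (L : R) (w h0 x h x' : 'rV[R]_d) :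
  0 < L -> L ^+ 2 + 2 * L <= 1 ->
  dot w w <= L ^+ 2 * dot (h - h0) (h - h0) ->
  2 * dot w (h - x') + L * dot (x' - h) (x' - h)
    <= dot (h - x) (h - x) + dot (x' - h) (x' - h)
       + L * dot (x - h0) (x - h0).
Proof.
move=> L0 L1 wL.
have Y := dotD_young (h - x) (x - h0) (ltW L0); rewrite addrA subrK in Y.
(* With this weight, the Young inequality turns the Lipschitz bound on [w] into
   the terms [|h - x|^2 + L |x - h0|^2], and leaves [L + L^2] in front of
   [|x' - h|^2]. *)
have m0 : 0 < L * (1 + L) by nra.
have W := dot_young w (h - x') m0.
have gE : dot (h - x') (h - x') = dot (x' - h) (x' - h).
  by rewrite -(opprB x' h) dotNl dotNr opprK.
rewrite gE in W.
have : (L * (1 + L))^-1 * dot w w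
    <= dot (h - x) (h - x) + L * dot (x - h0) (x - h0).
  by rewrite mulrC ler_pdivrMr//; nra.
have g0 := dot_ge0 (x' - h).
by nra.
Qed.

End Energy.

(** * Lyapunov inequality and summation *)

Section Convergence.
Variables (R : realType) (d : nat) (X : set 'rV[R]_d)
  (V : 'rV[R]_d -> 'rV[R]_d) (beta gamma : R).
Hypotheses (X_nonempty : X !=set0) (X_closed : closed X)
  (X_convex : convex_set X) (beta_gt0 : 0 < beta) (gamma_gt0 : 0 < gamma)
  (V_lipschitz : lipschitz_operator beta V).
Implicit Types (x xh : nat -> 'rV[R]_d) (p : 'rV[R]_d).

(** [|X_t - p|^2 + k |X_t - X_(t-1/2)|^2], for [t >= 1]. *)
Definition energy (k : R) x xh p (t : nat) : R :=
  dot (x t - p) (x t - p) + k * dot (x t - xh t.-1) (x t - xh t.-1).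

(** The step-size condition enters through [2 L <= 1] for PEG and OG, and
    through [L^2 + 2 L <= 1], that is, [L <= sqrt 2 - 1], for RG. *)
Lemma energy_decrease (alg : algorithm) x xh :
    gamma < 1 / (step_const alg * beta) -> run alg X V gamma x xh ->
  exists2 k, 0 <= k <= 1 & forall p t, X p -> (1 <= t)%N ->
    energy k x xh p t.+1 + 2 * gamma * dot (V (xh t)) (xh t - p)
      <= energy k x xh p t.
Proof.
have L0 : 0 < gamma * beta by exact: mulr_gt0.
have c0 : 0 < step_const alg :> R.
  by case: alg => /=; rewrite ?ltr0n// ltr_pwDl ?sqrtr_ge0.
rewrite ltr_pdivlMr ?mulr_gt0// mulrCA.
set L := gamma * beta in L0 *.
have lip u v := @lipschitz_sqr _ _ _ gamma V u v (ltW beta_gt0) V_lipschitz.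
rewrite -/L in lip.
have sv u v : 2 * gamma * dot (V u) v = 2 * dot (gamma *: V u) v.
  by rewrite dotZl mulrA.
case: alg {c0} => /= Lc.
- move=> [_ _ xE]; exists 1; first by rewrite ler01 lexx.
  move=> p t Xp t1; have [hE x'E] := xE t t1.
  rewrite /energy sv !mul1r /=.
  have := PEG_step X_nonempty X_closed X_convex (x t)
    (gamma *: V (xh t.-1)) (gamma *: V (xh t)) Xp.
  rewrite /= -hE -x'E => -[D g].
  have := past_gap (x t) (ltW L0) (ltW Lc) (lip _ _) g.
  by lra.
- move=> [Xx0 _ x1E xE]; exists L.
    rewrite ltW//=; have := sqrtr_ge0 (2 : R); nra.
  have s2 : Num.sqrt 2 ^+ 2 = 2 :> R by rewrite sqr_sqrtr.
  have s0 := sqrtr_ge0 (2 : R).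
  have L1 : L ^+ 2 + 2 * L <= 1 by nra.
  have xprev t : X (x t) /\ x t.+1 = Defs.proj X (x t - gamma *: V (xh t)).
    elim: t => [//|t [_ IH]]; split; last by have [] := xE t.+1 isT.
    by rewrite IH; exact: proj_in.
  move=> p [//|t] Xp _; have [hE _] := xE t.+1 isT.
  have [[Xxt xtE] [_ x'E]] := (xprev t, xprev t.+1).
  rewrite /energy sv /= in hE *.
  have D := RG_step X_nonempty X_closed X_convex Xp Xxt xtE x'E hE.
  have := reflected_gap (x t.+1) (x t.+2) L0 L1 (lip (xh t) (xh t.+1)).
  by lra.
- move=> [_ _ xE]; exists 1; first by rewrite ler01 lexx.
  move=> p t Xp t1; have [hE x'E] := xE t t1.
  rewrite /energy sv !mul1r /=.
  have := OG_step X_nonempty X_closed X_convex (x t)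
    (gamma *: V (xh t.-1)) (gamma *: V (xh t)) Xp.
  rewrite /= -hE -x'E => -[D g].
  have := past_gap (x t) (ltW L0) (ltW Lc) (lip _ _) g.
  by lra.
Qed.

Lemma run_x1_in (alg : algorithm) x xh : run alg X V gamma x xh -> X (x 1%N).
Proof. by case: alg => -[] // _ _ -> _; exact: proj_in. Qed.

Lemma sum_le_energy k x xh p (t : nat) : 0 <= k <= 1 -> X p ->
    (forall p t, X p -> (1 <= t)%N ->
      energy k x xh p t.+1 + 2 * gamma * dot (V (xh t)) (xh t - p)
        <= energy k x xh p t) ->
  \sum_(1 <= s < t.+1) 2 * gamma * dot (V (xh s)) (xh s - p)
    <= dot (x 1%N - p) (x 1%N - p)
       + dot (x 1%N - xh 0%N) (x 1%N - xh 0%N).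
Proof.
move=> /andP[k0 k1] Xp dec.
have energy_ge0 s : 0 <= energy k x xh p s.
  by rewrite addr_ge0 ?mulr_ge0 ?dot_ge0.
apply: (@le_trans _ _ (energy k x xh p 1 - energy k x xh p t.+1)).
  rewrite -opprB -telescope_sumr// -sumrN !big_nat.
  apply: ler_sum => s /andP[s1 _].
  by have := dec p s Xp s1; lra.
have : k * dot (x 1%N - xh 0%N) (x 1%N - xh 0%N)
    <= dot (x 1%N - xh 0%N) (x 1%N - xh 0%N) by rewrite ler_piMl ?dot_ge0.
by have := energy_ge0 t.+1; rewrite {2}/energy /=; lra.
Qed.

End Convergence.

Lemma dot_ergodic_average (R : realType) (d : nat) (xh : nat -> 'rV[R]_d)
    (t : nat) (v p : 'rV[R]_d) : (1 <= t)%N ->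
  t%:R * dot v (ergodic_average xh t - p)
    = \sum_(1 <= s < t.+1) dot v (xh s - p).
Proof.
move=> t1; have tn0 : t%:R != 0 :> R by rewrite pnatr_eq0 -lt0n.
rewrite dotDr dotNr dotZr mulrBr mulrA divff// mul1r dot_sumr.
under [RHS]eq_bigr do rewrite dotDr dotNr.
by rewrite sumrB sumr_const_nat subn1 /= mulr_natl.
Qed.

Theorem theorem1 (R : realType) (d : nat) (alg : algorithm)
    (X : set 'rV[R]_d) (V : 'rV[R]_d -> 'rV[R]_d) (beta gamma : R)
    (x xh : nat -> 'rV[R]_d)
    (X_nonempty : X !=set0) (X_closed : closed X) (X_convex : convex_set X)
    (beta_gt0 : 0 < beta) (V_monotone : monotone_operator V)
    (V_lipschitz : lipschitz_operator beta V)
    (VI_solvable : exists xs, vi_solution X V xs)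
    (gamma_gt0 : 0 < gamma) (gamma_lt : gamma < 1 / (step_const alg * beta))
    (alg_run : run alg X V gamma x xh)
    (r : R) (r_gt0 : 0 < r) (t : nat) (t_ge1 : (1 <= t)%N) :
  Err X V (x 1%N) r (ergodic_average xh t)
    <= (r ^+ 2 + enorm (x 1%N - xh 0%N) ^+ 2) / (2 * gamma * t%:R).
Proof.
have Xx1 := run_x1_in X_nonempty X_closed alg_run.
have [[p [Xp pr] <-] _] :=
  Err_max (ergodic_average xh t) X_closed Xx1 (ltW r_gt0) V_lipschitz.
have [k k01 dec] := energy_decrease X_nonempty X_closed X_convex beta_gt0
  gamma_gt0 V_lipschitz gamma_lt alg_run.
have t0 : 0 < t%:R :> R by rewrite ltr0n.
rewrite ler_pdivlMr ?mulr_gt0// mulrC -[_ * t%:R * _]mulrA.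
rewrite dot_ergodic_average// mulr_sumr.
have sum_le := sum_le_energy t k01 Xp dec.
apply: (@le_trans _ _
    (\sum_(1 <= s < t.+1) 2 * gamma * dot (V (xh s)) (xh s - p))).
  apply: ler_sum => s _; rewrite ler_pM2l ?mulr_gt0// -subr_ge0 -dotNl -dotDl.
  exact: V_monotone.
apply: le_trans sum_le _; rewrite sqr_enorm lerD2r -sqr_enorm enormC.
by rewrite ler_pXn2r ?nnegrE ?enorm_ge0 ?(ltW r_gt0).
Qed.
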